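(* There exist a universal constant $C>0$ and a function $q\mapsto C_q\in(0,\infty)$ on $(2,\infty)$ such that the following holds. Let $n\in\mathbb{N}$, $q\in(2,\infty)$, and let $(W_i)_{i=1}^n$ be i.i.d. non-negative random variables such that for all $t>0$, $$\mathbb{P}\{W_i>t\}=e^{q/2}(e+t)^{-q/2}\left(\ln(e+t)\right)^{q/2}.$$ Then for all $b\in[0,\infty)^n$ and all $t>0$, with probability at least $1-Ce^{-t^2/2}$, $$\sum_{i=1}^n b_iW_i\leq C_q\left(|b|_1+t^2e^{t^2/q}|b|_{q/2}\right).$$
   Context: For $p\geq 1$, $|b|_p=\left(\sum_{i=1}^n|b_i|^p\right)^{1/p}$. The constant $C$ is universal and $C_q$ depends only on $q$. *)

(* Defs.v *)
From HB Require Import structures.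
From mathcomp Require Import all_boot all_order all_algebra.
From mathcomp Require Import all_classical all_reals all_analysis.

Set Implicit Arguments.
Unset Strict Implicit.
Unset Printing Implicit Defensive.

Import Order.TTheory GRing.Theory Num.Theory.
Import numFieldNormedType.Exports.

Local Open Scope classical_set_scope.
Local Open Scope ring_scope.

Definition pnorm (R : realType) (n : nat) (p : R) (b : 'I_n -> R) : R :=
  (\sum_(i < n) `|b i| `^ p) `^ p^-1.

(* Mutual independence: the product rule over every subfamily, for Borel sets. *)
Definition mutually_independent (R : realType) (d : measure_display)
    (T : measurableType d) (P : probability T R) (I : finType)
    (X : I -> {RV P >-> R}) : Prop :=
  forall (J : {set I}) (B : I -> set R), (forall i, measurable (B i)) ->
    P (\bigcap_(i in [set` J]) (X i @^-1` B i)) =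
    (\prod_(i in J) P (X i @^-1` B i))%E.

Definition identically_distributed (R : realType) (d : measure_display)
    (T : measurableType d) (P : probability T R) (I : finType)
    (X : I -> {RV P >-> R}) : Prop :=
  forall (i j : I) (B : set R), measurable B ->
    distribution P (X i) B = distribution P (X j) B.

Definition iid (R : realType) (d : measure_display)
    (T : measurableType d) (P : probability T R) (I : finType)
    (X : I -> {RV P >-> R}) : Prop :=
  mutually_independent X /\ identically_distributed X.

(* Main.v *)
Require Import Defs.
From HB Require Import structures.
From mathcomp Require Import all_boot all_order all_algebra.
From mathcomp Require Import all_classical all_reals all_analysis.
From mathcomp Require Import ring lra.

Set Implicit Arguments.
Unset Strict Implicit.
Unset Printing Implicit Defensive.

Import Order.TTheory GRing.Theory Num.Theory.
Import numFieldNormedType.Exports.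

Local Open Scope classical_set_scope.
Local Open Scope ring_scope.

(* Put p = q / 2 = 1 + 3 d and u = t ^ 2 / 2; if u < 1 the bound is void for
   C = 2 e.  Rescale the weights to a_i = b_i / (K (|b|_1 + u e^(u/p) |b|_p)), so
   that sum a_i <= 1 / K and sum a_i^p <= e^(-u) / (K u^p).
   - One big jump: P(a_i W_i > 1) is at most a constant times
     u^p a_i^p + e^(-u) a_i.  When a_i >= e^(-u/(2d)) the logarithm in the tail
     is O(u); otherwise the tail bound O(t^-(1+2d)) leaves a_i times
     a_i^(2d) <= e^(-u).
   - No big jump: replace W_i by the next power of 2 and truncate a_i W_i at 2.
     The variables then take finitely many values, so the Chernoff bound with
     parameter l = u / (3 (3 + d)) only expands a product over finite functions.
     Its exponent is O(l sum a_i + e^(2l) l^(1+d) sum a_i^(1+d)) = O(u), because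
     interpolation between the exponents 1 and p gives
     sum a_i^(1+d) <= 2 e^(-u/3). *)

(** * Union bound and Chernoff bound for variables with finitely many values *)

Lemma union_bound (R : realType) (d : measure_display) (T : measurableType d)
    (P : probability T R) (I : finType) (Q : pred I) (A : set T)
    (F : I -> set T) :
  measurable A -> (forall i, measurable (F i)) ->
  (forall w, A w -> exists2 i, Q i & F i w) ->
  (P A <= \sum_(i | Q i) P (F i))%E.
Proof.
move=> mA mF AF.
have mU (s : seq I) : measurable (\big[setU/set0]_(i <- s | Q i) F i).
  by apply: bigsetU_measurable => i _; exact: mF.
apply: (@le_trans _ _ (P (\big[setU/set0]_(i | Q i) F i))).
  apply: le_measure; rewrite ?inE// => w /AF [i Qi Fi].
  by rewrite -bigcup_seq_cond; exists i => //=; rewrite mem_index_enum.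
elim: (index_enum I) => [|i s IH]; first by rewrite !big_nil measure0.
rewrite !big_cons; case: ifP => // _.
by apply: (le_trans (measureU2 _ (mF i) (mU s))); rewrite leeD2l.
Qed.

Lemma measurable_fun_fin (R : realType) (d : measure_display)
    (T : measurableType d) (K : finType) (f : T -> K) (g : K -> R) :
  (forall k, measurable [set w | f w = k]) ->
  measurable_fun setT (fun w => g (f w)).
Proof.
move=> mf _ Y _; rewrite setTI.
rewrite (_ : _ @^-1` _ = \bigcup_(k in [set k | Y (g k)]) [set w | f w = k]).
  exact: fin_bigcup_measurable.
by apply/seteqP; split => [w Yw|w [k Yk /= ->]//]; exists (f w).
Qed.

Lemma measurable_superlevel (R : realType) (d : measure_display)
    (T : measurableType d) (f : T -> R) (y : R) :
  measurable_fun setT f -> measurable [set w | y < f w].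
Proof.
move=> mf; rewrite (_ : [set _ | _] = setT `&` f @^-1` [set` `]y, +oo[]).
  exact: mf.
by apply/seteqP; split => [w|w []] /=; rewrite in_itv/= andbT.
Qed.

(** The event is covered by the joint level sets of those [f : {ffun I -> K}] whose total exceeds
    [y]. Independence factors their probabilities, and each such [f] may be weighted by
    [expR (l * (\sum_i c i (f i) - y))], which is at least 1. Summing over all [f] and exchanging
    sum with product gives the bound without any integral. *)
Lemma chernoff_finite (R : realType) (d : measure_display)
    (T : measurableType d) (P : probability T R) (I K : finType)
    (W : I -> {RV P >-> R}) (lev : R -> K) (c : I -> K -> R) (l y : R) :
  mutually_independent W ->
  (forall k, measurable [set x | lev x = k]) ->
  0 <= l ->
  (P [set w | (y < \sum_i c i (lev (W i w)))%R] <=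
   (expR (- (l * y)) *
    \prod_i \sum_k fine (P [set w | lev (W i w) = k]) * expR (l * c i k))%:E)%E.
Proof.
move=> indW mlev l0.
have mF i k : measurable [set w | lev (W i w) = k].
  rewrite (_ : [set _ | _] = W i @^-1` [set x | lev x = k])//.
  by rewrite -[X in measurable X]setTI; exact: measurable_funPT.
pose F (f : {ffun I -> K}) := \bigcap_(i in [set: I]) [set w | lev (W i w) = f i].
have mFf f : measurable (F f).
  by apply: fin_bigcap_measurable => // i _; exact: mF.
have PF f : P (F f) = (\prod_i fine (P [set w | lev (W i w) = f i]))%:E.
  have /(_ [set: I]%SET (fun i => [set x | lev x = f i])) := indW.
  move=> /(_ (fun i => mlev (f i))).
  have -> : [set` [set: I]%SET] = [set: I] by apply/seteqP; split => i //= _; rewrite inE.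
  move=> ->; rewrite -prodEFin big_mkcond/=; apply: eq_bigr => i _.
  by rewrite inE fineK// fin_num_measure.
have mS : measurable [set w | y < \sum_i c i (lev (W i w))].
  apply: measurable_superlevel; apply: measurable_sum => i.
  exact: measurable_fun_fin.
pose Q (f : {ffun I -> K}) := y < \sum_i c i (f i).
apply: (le_trans (union_bound P (Q := Q) mS mFf _)).
  move=> w yw; exists [ffun i => lev (W i w)] => /=.
    by rewrite /Q; under eq_bigr do rewrite ffunE.
  by move=> i _ /=; rewrite ffunE.
rewrite (eq_bigr _ (fun f _ => PF f)) sumEFin lee_fin bigA_distr_bigA/= mulr_sumr.
rewrite big_mkcond/=; apply: ler_sum => f _.
have p0 i : 0 <= fine (P [set w | lev (W i w) = f i]) by exact: fine_ge0.
case: ifPn => [yf|_]; last first.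
  rewrite mulr_ge0 ?expR_ge0// prodr_ge0// => i _.
  by rewrite mulr_ge0 ?expR_ge0.
rewrite big_split/= -expR_sum mulrCA -expRD ler_peMr ?prodr_ge0//.
by rewrite -expR0 ler_expR -mulr_sumr addrC subr_ge0 ler_wpM2l// ltW.
Qed.

Lemma sum_fibers_le1 (R : realType) (d : measure_display)
    (T : measurableType d) (P : probability T R) (N : nat) (f : T -> 'I_N) :
  (forall k, measurable [set w | f w = k]) ->
  \sum_k fine (P [set w | f w = k]) <= 1.
Proof.
move=> mf; rewrite -lee_fin -sumEFin.
rewrite (eq_bigr (fun k => P [set w | f w = k])); last first.
  by move=> k _; rewrite fineK// fin_num_measure.
rewrite -(measure_bigsetU_ord P xpredT mf); last first.
  by move=> i j _ _ [w [/= <- <-]].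
by apply: probability_le1; exact: bigsetU_measurable.
Qed.

(** * Rounding up to powers of 2 *)

(* The least [k <= N] with [x <= 2 ^+ k], and [N.+1] if there is none. *)
Definition dyadic_level (R : realType) (N : nat) (x : R) : 'I_N.+2 :=
  inord (find (fun k => x <= 2 ^+ k) (iota 0 N.+1)).

Lemma dyadic_levelE (R : realType) (N : nat) (x : R) :
  dyadic_level N x = find (fun k => x <= 2 ^+ k) (iota 0 N.+1) :> nat.
Proof.
by rewrite inordK// ltnS (leq_trans (find_size _ _))// size_iota.
Qed.

(** Powers of 2 increase with the exponent, so the first index passing the test is at most [k]
    exactly when [k] passes it. *)
Lemma dyadic_level_leP (R : realType) (N : nat) (x : R) (k : nat) :
  (k <= N)%N -> (dyadic_level N x <= k)%N = (x <= 2 ^+ k).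
Proof.
move=> kN; rewrite dyadic_levelE; set s := iota 0 N.+1.
have nths j : (j <= N)%N -> nth 0%N s j = j by move=> jN; rewrite nth_iota.
apply/idP/idP => [fk|xk].
  have := fk; rewrite -ltnS => /leq_trans /(_ (kN : (k.+1 <= N.+1)%N)).
  rewrite -[X in (_ < X)%N](size_iota 0 N.+1) -has_find => /(nth_find 0%N)/=.
  rewrite -/s nths ?(leq_trans fk)// => /le_trans; apply.
  by rewrite ler_weXn2l// ler1n.
rewrite leqNgt; apply/negP => /(before_find 0%N).
by rewrite nths// xk.
Qed.

Lemma measurable_dyadic_level (R : realType) (N : nat) (k : 'I_N.+2) :
  measurable [set x : R | dyadic_level N x = k].
Proof.
have mle (j : nat) : measurable [set x : R | (dyadic_level N x <= j)%N].
  have [jN|Nj] := leqP j N.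
    rewrite (_ : [set _ | _] = [set` `]-oo, (2 ^+ j : R)]]); first exact: measurable_itv.
    by apply/seteqP; split => x /=; rewrite dyadic_level_leP// in_itv.
  rewrite (_ : [set _ | _] = setT)//; apply/seteqP; split => x //= _.
  by rewrite (leq_trans _ Nj)// -ltnS.
case: k => -[|k] kN.
  rewrite (_ : [set _ | _] = [set x : R | (dyadic_level N x <= 0)%N])//.
  apply/seteqP; split => x /=; first by move->.
  by rewrite leqn0 => /eqP ?; apply/val_inj.
rewrite (_ : [set _ | _] = [set x | (dyadic_level N x <= k.+1)%N] `\`
                           [set x | (dyadic_level N x <= k)%N]).
  exact: measurableD.
apply/seteqP; split => x /=; first by move=> ->/=; rewrite ltnn.
move=> [le1 /negP]; rewrite -ltnNge => lt1; apply/val_inj/eqP => /=.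
by rewrite eqn_leq le1.
Qed.

Lemma measurable_dyadic_level_RV (R : realType) (d : measure_display)
    (T : measurableType d) (P : probability T R) (X : {RV P >-> R})
    (N : nat) (k : 'I_N.+2) :
  measurable [set w | dyadic_level N (X w) = k].
Proof.
rewrite (_ : [set _ | _] = X @^-1` [set x | dyadic_level N x = k])//.
rewrite -[X in measurable X]setTI; apply: measurable_funPT => //.
exact: measurable_dyadic_level.
Qed.

(** * Bounds on the survival function *)

(* The survival function of [W_i], with [p = q / 2]; see [WtailE]. *)
Definition Wtail (R : realType) (p t : R) : R :=
  (expR 1 * ln (expR 1 + t) / (expR 1 + t)) `^ p.

Lemma expR1_ge1 (R : realType) : (1 : R) <= expR 1.
Proof. by rewrite -expR0 ler_expR. Qed.

Lemma WtailE (R : realType) (p t : R) : 0 <= t ->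
  Wtail p t = expR p * (expR 1 + t) `^ (- p) * ln (expR 1 + t) `^ p.
Proof.
move=> t0; have e1 := expR1_ge1 R.
have et0 : 0 <= expR 1 + t by lra.
have ln0 : 0 <= ln (expR 1 + t) by apply: ln_ge0; lra.
rewrite /Wtail powRM ?mulr_ge0 ?invr_ge0 ?expR_ge0//.
rewrite powRM ?expR_ge0// -expRM mul1r powRN -[X in _ * X `^ p]powR_inv1//.
by rewrite -powRrM mulN1r powRN; ring.
Qed.

(** The inequality [ln y <= y ^ s / s] with [s = (p - r) / p] absorbs the logarithm and lowers the
    decay exponent from [p] to [r]. *)
Lemma Wtail_le (R : realType) (p r t : R) : 0 < p -> 0 <= r -> r < p -> 0 < t ->
  Wtail p t <= (expR 1 * (p / (p - r))) `^ p * t `^ (- r).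
Proof.
move=> p0 r0 rp t0; have e1 := expR1_ge1 R.
set y := expR 1 + t.
have y0 : 0 < y by rewrite /y; lra.
have pr0 : 0 < p - r by lra.
have lny : ln y <= p / (p - r) * y `^ ((p - r) / p).
  rewrite -ler_pdivrMl ?divr_gt0// invf_div -ln_powR.
  by apply/ltW/ln_sublinear; exact: powR_gt0.
have lny0 : 0 <= ln y by apply: ln_ge0; rewrite /y; lra.
have c0 : 0 <= expR 1 * (p / (p - r)).
  by rewrite mulr_ge0 ?expR_ge0// divr_ge0 ?ltW.
apply: (@le_trans _ _ ((expR 1 * (p / (p - r)) * y `^ ((p - r) / p - 1)) `^ p)).
  rewrite /Wtail -/y ge0_ler_powR ?(ltW p0)// ?nnegrE.
  - by rewrite mulr_ge0 ?invr_ge0 ?(ltW y0)// mulr_ge0// expR_ge0.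
  - by rewrite mulr_ge0// powR_ge0.
  - rewrite powRD ?(gt_eqF y0) ?implybT// powR_inv1 ?(ltW y0)// mulrA.
    by rewrite ler_wpM2r ?invr_ge0 ?(ltW y0)// -mulrA ler_wpM2l ?expR_ge0.
rewrite powRM ?powR_ge0// ler_wpM2l ?powR_ge0// -powRrM.
have -> : ((p - r) / p - 1) * p = - r by field; rewrite gt_eqF.
rewrite !powRN lef_pV2 ?posrE ?powR_gt0// ge0_ler_powR ?nnegrE ?(ltW t0) ?(ltW y0)//.
by rewrite /y; lra.
Qed.

(** The two constants come from the two regimes of [a]: the first from the one where the logarithm
    is at most [(2 + M) * u], the second from [Wtail_le] with [r = 1 + 2 * d], for which
    [p - r = d]. *)
Lemma Wtail_inv_le (R : realType) (p d u a : R) : p = 1 + 3 * d -> 0 < d -> 1 <= u ->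
    0 < a -> a <= 1 ->
  Wtail p a^-1 <= ((expR 1 * (2 + (2 * d)^-1)) `^ p + (expR 1 * (p / d)) `^ p) *
                  (u `^ p * a `^ p + expR (- u) * a).
Proof.
move=> pE d0 u1 a0 a1; have e1 := expR1_ge1 R.
set A := _ `^ p; set B := _ `^ p.
have A0 : 0 <= A := powR_ge0 _ _.
have B0 : 0 <= B := powR_ge0 _ _.
have X0 : 0 <= u `^ p * a `^ p by rewrite mulr_ge0 ?powR_ge0.
have Y0 : 0 <= expR (- u) * a by rewrite mulr_ge0 ?expR_ge0 ?ltW.
have p0 : 0 < p by lra.
set M := (2 * d)^-1.
have M0 : 0 < M by rewrite invr_gt0; lra.
have ia1 : 1 <= a^-1 by rewrite invf_ge1.
(* The threshold is the value of [a] at which [a ^ (2 * d)] equals [expR (- u)]. *)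
have [aM|Ma] := leP a (expR (- (M * u))).
  apply: (@le_trans _ _ (B * (expR (- u) * a))); last by nra.
  have r0 : 0 <= 1 + 2 * d by lra.
  have rp : 1 + 2 * d < p by lra.
  have ia0 : 0 < a^-1 by rewrite invr_gt0.
  apply: (le_trans (Wtail_le p0 r0 rp ia0)).
  rewrite (_ : p - (1 + 2 * d) = d); last by rewrite pE; ring.
  rewrite ler_wpM2l// -powR_inv1 ?(ltW a0)// -powRrM mulN1r opprK.
  rewrite powRD ?(gt_eqF a0) ?implybT// powRr1 ?(ltW a0)// mulrC.
  rewrite ler_wpM2r ?(ltW a0)//.
  apply: (@le_trans _ _ (expR (- (M * u)) `^ (2 * d))).
    by rewrite ge0_ler_powR ?nnegrE ?expR_ge0 ?(ltW a0)//; lra.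
  rewrite -expRM ler_expR /M le_eqVlt; apply/orP; left; apply/eqP.
  by field; rewrite gt_eqF.
apply: (@le_trans _ _ (A * (u `^ p * a `^ p))); last by nra.
rewrite /A -/M -!powRM ?mulr_ge0 ?expR_ge0 ?(ltW a0)//; [|lra..].
have ln0 : 0 <= ln (expR 1 + a^-1) by apply: ln_ge0; lra.
have ea0 : 0 < expR 1 + a^-1 by lra.
rewrite ge0_ler_powR ?(ltW p0)// ?nnegrE.
- by rewrite mulr_ge0 ?invr_ge0 ?(ltW ea0)// mulr_ge0// expR_ge0.
- by rewrite !mulr_ge0 ?expR_ge0 ?(ltW a0)//; lra.
(* Here [a^-1 <= expR (M * u)], adding [expR 1] costs at most a factor [expR 2], and [u >= 1] turns
   [2 + M * u] into [(2 + M) * u]. *)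
have lnu : ln (expR 1 + a^-1) <= (2 + M) * u.
  have Mu0 : 0 <= M * u by nra.
  have aV : a^-1 <= expR (M * u).
    by rewrite -[M * u]opprK expRN lef_pV2 ?posrE ?expR_gt0// ltW.
  rewrite -[leRHS]expRK ler_ln ?posrE ?expR_gt0//.
  apply: (@le_trans _ _ (expR (2 + M * u))); last by rewrite ler_expR; nra.
  have eMu : 1 <= expR (M * u) by rewrite -expR0 ler_expR.
  have e2 : 2 <= expR 1 :> R by have := expR_ge1Dx (1 : R); lra.
  rewrite expRD (_ : 2 = 1 + 1 :> R)// expRD -mulrA.
  have : 2 * (expR 1 * expR (M * u)) <= expR 1 * (expR 1 * expR (M * u)).
    by rewrite ler_wpM2r ?mulr_ge0 ?expR_ge0.
  by nra.
rewrite -mulrA -[leRHS]mulrA ler_wpM2l ?expR_ge0// [leRHS]mulrA.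
apply: ler_pM => //.
  by rewrite invr_ge0 ltW.
by rewrite -[leRHS]invrK lef_pV2 ?posrE ?invr_gt0//; lra.
Qed.

(** * Elementary inequalities and the exponential moment of a capped variable *)

(** For [x <= 1], [1 - x <= expR (- x)] gives [expR x <= 1 + x * expR x], and the linear term
    suffices. For [x > 1], [x ^ s >= 1] and the last term suffices. *)
Lemma expR_le_affine_powR (R : realType) (s x y : R) : 0 <= x -> x <= y ->
  0 <= s -> expR x <= 1 + expR 1 * x + expR y * x `^ s.
Proof.
move=> x0 xy s0; have Ey := expR_gt0 y.
have [x1|x1] := leP x 1.
  have : 1 - x <= expR (- x) by exact: expR_ge1Dx.
  rewrite expRN => /(ler_wpM2r (expR_ge0 x)); rewrite mulVf ?gt_eqF ?expR_gt0//.
  have : expR x <= expR 1 by rewrite ler_expR.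
  by have := powR_ge0 x s; nra.
have : 1 <= x `^ s by rewrite -[leLHS](powRr0 x) ler_powR// ltW.
have : expR x <= expR y by rewrite ler_expR.
have := expR_gt0 (1 : R); nra.
Qed.

Lemma powR_interpolate (R : realType) (d u a : R) : 0 < d -> 0 <= a ->
  a `^ (1 + d) <= expR (- (u / 3)) * (a + expR u * a `^ (1 + 3 * d)).
Proof.
move=> d0; rewrite le_eqVlt => /predU1P[<-|a0].
  rewrite powR0; last by rewrite gt_eqF//; lra.
  by rewrite add0r mulr_ge0 ?expR_ge0 ?mulr_ge0 ?expR_ge0 ?powR_ge0.
(* With [z = exp (u / 3) * a ^ d] the claim reduces to [z <= 1 + z ^ 3]. *)
pose z := expR (u / 3) * a `^ d.
have z0 : 0 < z by rewrite mulr_gt0 ?expR_gt0 ?powR_gt0.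
have -> : a `^ (1 + d) = expR (- (u / 3)) * (a * z).
  rewrite powRD ?(gt_eqF a0) ?implybT// powRr1 ?(ltW a0)// /z expRN.
  by field; rewrite gt_eqF ?expR_gt0.
have -> : expR u * a `^ (1 + 3 * d) = a * z ^+ 3.
  rewrite powRD ?(gt_eqF a0) ?implybT// powRr1 ?(ltW a0)// /z exprMn.
  have -> : a `^ (3 * d) = (a `^ d) ^+ 3.
    by rewrite mulrC powRrM powR_mulrn ?powR_ge0.
  have -> : expR (u / 3) ^+ 3 = expR u by rewrite -expRM_natl; congr expR; field.
  by ring.
rewrite ler_wpM2l ?expR_ge0// -[X in X + _]mulr1 -mulrDr ler_wpM2l ?(ltW a0)//.
by have [z1|z1] := leP z 1; have := sqr_ge0 z; rewrite !exprS expr0; nra.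
Qed.

(* The value of [a * x] rounded up to level [k] of [x]; the levels that force
   [1 < a * x] get the junk value [0], as does the unbounded level [N.+1]. *)
Definition capped (R : realType) (N : nat) (a : R) (k : 'I_N.+2) : R :=
  if (k <= N)%N && (a * 2 ^+ k < 2) then a * 2 ^+ k else 0.

(** The bound on [a^-1] keeps [x] below the top level. At a positive level, rounding up less than
    doubles [x], so the rounded product stays below 2; at level 0 the rounded product is [a <= 1].
    Hence the cap never acts. *)
Lemma le_capped_dyadic (R : realType) (N : nat) (a x : R) :
  0 <= a -> a <= 1 -> a^-1 <= 2 ^+ N -> a * x <= 1 ->
  a * x <= capped a (dyadic_level N x).
Proof.
rewrite le_eqVlt => /predU1P[<-|a0] a1 aN ax.
  by rewrite mul0r /capped; case: ifP; rewrite mul0r.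
have xa : x <= a^-1 by rewrite -[a^-1]mul1r ler_pdivlMr// mulrC.
have lN : (dyadic_level N x <= N)%N.
  by rewrite dyadic_level_leP// (le_trans xa).
have xl : x <= 2 ^+ dyadic_level N x by rewrite -(@dyadic_level_leP _ N).
rewrite /capped lN /=; case: ifPn => [_|/negP[]]; first by rewrite ler_pM2l.
case E: (nat_of_ord (dyadic_level N x)) => [|k]; first by rewrite expr0; lra.
have : 2 ^+ k < x.
  rewrite ltNge -(@dyadic_level_leP _ N); first by rewrite E ltnn.
  by rewrite (leq_trans _ lN)// E.
by rewrite -(ltr_pM2l a0) exprS; lra.
Qed.

Lemma geometric_sum_le (R : realType) (N : nat) (z : R) : 0 <= z -> z < 1 ->
  \sum_(k < N) z ^+ k <= (1 - z)^-1.
Proof.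
move=> z0 z1; rewrite -[leRHS]mul1r ler_pdivlMr; last by lra.
rewrite mulrC -[1 - z]opprB mulNr -subrX1 opprB lerBlDr lerDl.
by rewrite exprn_ge0.
Qed.

(** On level [k] the argument of the exponential is at most [2 * l], so [expR_le_affine_powR] with
    exponent [1 + d] applies. Against the decay [1 + 2 * d] of [p k] this leaves a geometric series
    of ratio [2 ^ (- d)]; levels where [capped] vanishes contribute only [p k]. *)
Lemma capped_mgf_le (R : realType) (N : nat) (p : 'I_N.+2 -> R)
    (a l d B : R) :
  0 <= a -> 0 <= l -> 0 < d -> 0 <= B ->
  (forall k, 0 <= p k) -> \sum_k p k <= 1 ->
  (forall k : 'I_N.+2, (k <= N)%N -> p k <= B * (2 ^+ k) `^ (- (1 + 2 * d))) ->
  \sum_k p k * expR (l * capped a k) <=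
  1 + B / (1 - 2 `^ (- d)) *
      (expR 1 * l * a + expR (2 * l) * l `^ (1 + d) * a `^ (1 + d)).
Proof.
move=> a0 l0 d0 B0 p0 p1 pB.
set E := expR 1 * l * a + _.
have E0 : 0 <= E.
  by rewrite addr_ge0// ?mulr_ge0 ?expR_ge0 ?powR_ge0.
set z := 2 `^ (- d).
have z0 : 0 <= z := powR_ge0 _ _.
have z1 : z < 1.
  by rewrite /z powRN invf_lt1 ?powR_gt0//; have := @gt0_ltr_powR R d d0 1 2; rewrite powR1 !nnegrE; apply; lra.
have step k : p k * expR (l * capped a k) <= p k + E * B * z ^+ k.
  rewrite /capped; case: ifPn => [/andP[kN ak]|_]; last first.
    by rewrite mulr0 expR0 mulr1 lerDl !mulr_ge0 ?exprn_ge0.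
  have t1 : 1 <= 2 ^+ k :> R by rewrite exprn_ege1 ?ler1n.
  set t := 2 ^+ k in ak t1 *.
  have t0 : 0 < t by lra.
  have at0 : 0 <= a * t by rewrite mulr_ge0 ?(ltW t0).
  have s0 : 0 <= 1 + d by lra.
  have H : expR (l * (a * t)) <= 1 + E * t `^ (1 + d).
    have le2 : l * (a * t) <= 2 * l by nra.
    have le0 : 0 <= l * (a * t) by rewrite mulr_ge0.
    apply: (le_trans (expR_le_affine_powR le0 le2 s0)).
    rewrite !powRM ?(ltW t0)// /E -addrA lerD2l [leRHS]mulrDl lerD//; last by rewrite !mulrA.
    (* Since [t >= 1], the linear term in [t] is also dominated by [t ^ (1 + d)]. *)
    rewrite !mulrA ler_wpM2l ?mulr_ge0 ?expR_ge0// le1r_powR//; lra.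
  apply: (le_trans (ler_wpM2l (p0 k) H)).
  rewrite mulrDr mulr1 lerD2l mulrCA -mulrA ler_wpM2l//.
  have -> : z ^+ k = t `^ (- (1 + 2 * d)) * t `^ (1 + d).
    rewrite -powRD ?(gt_eqF t0) ?implybT// (_ : _ + _ = - d); last by ring.
    rewrite /z -(powR_mulrn k z0) /t -(powR_mulrn k (ler0n R 2)).
    by rewrite -(powRrM 2 (- d)) -(powRrM 2 k%:R) mulrC.
  by rewrite mulrA ler_wpM2r ?powR_ge0// pB.
apply: (@le_trans _ _ (\sum_k (p k + E * B * z ^+ k))); first exact: ler_sum.
rewrite big_split/= lerD// -mulr_sumr (_ : B / _ * E = E * B / (1 - z)); last by ring.
by rewrite ler_wpM2l ?mulr_ge0// geometric_sum_le.
Qed.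

(** * Tail estimates: one big jump, the capped sum, and their combination *)

Lemma max_jump_tail (R : realType) (dT : measure_display)
    (T : measurableType dT) (P : probability T R) (n : nat)
    (W : 'I_n -> {RV P >-> R}) (p d u : R) (a : 'I_n -> R) :
  p = 1 + 3 * d -> 0 < d -> 1 <= u ->
  (forall i (t : R), 0 < t -> P [set w | t < W i w] = (Wtail p t)%:E) ->
  (forall i, 0 <= a i) -> (forall i, a i <= 1) ->
  (\sum_i P [set w | (1 < a i * W i w)%R] <=
   (((expR 1 * (2 + (2 * d)^-1)) `^ p + (expR 1 * (p / d)) `^ p) *
     (u `^ p * (\sum_i a i `^ p) + expR (- u) * \sum_i a i)%R)%:E)%E.
Proof.
move=> pE d0 u1 tailW a0 a1.
set D : R := _ `^ p + _.
have D0 : 0 <= D by rewrite addr_ge0 ?powR_ge0.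
rewrite !mulr_sumr -big_split/= mulr_sumr -sumEFin; apply: lee_sum => i _.
(* A zero weight never jumps; it is set apart because its inverse is 0 by convention. *)
have [ai0|ai0] := eqVneq (a i) 0.
  rewrite (_ : [set w | _] = set0); last first.
    by apply/seteqP; split => w //=; rewrite ai0 mul0r ltr10.
  by rewrite measure0 lee_fin mulr_ge0// ai0 mulr0 addr0 mulr_ge0 ?powR_ge0.
have ai : 0 < a i by rewrite lt_neqAle eq_sym ai0 a0.
rewrite (_ : [set w | _] = [set w | (a i)^-1 < W i w]); last first.
  apply/seteqP; split => w /=; by rewrite -[_^-1]mul1r ltr_pdivrMr// mulrC.
by rewrite tailW ?invr_gt0// lee_fin Wtail_inv_le.
Qed.

(** Level [k.+1] forces the variable above [2 ^+ k], which costs the factor [2 ^ r]. Level 0 has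
    only the trivial bound 1, whence the assumption [1 <= B]. *)
Lemma dyadic_level_prob_le (R : realType) (dT : measure_display)
    (T : measurableType dT) (P : probability T R) (X : {RV P >-> R})
    (B r : R) (N : nat) (k : 'I_N.+2) :
  1 <= B -> 0 <= r ->
  (forall t : R, 0 < t -> (P [set w | (t < X w)%R] <= (B * t `^ (- r))%:E)%E) ->
  (k <= N)%N ->
  fine (P [set w | dyadic_level N (X w) = k]) <=
  B * 2 `^ r * (2 ^+ k) `^ (- r).
Proof.
move=> B1 r0 tailX kN.
have mlev := measurable_dyadic_level_RV X k.
rewrite -lee_fin fineK ?fin_num_measure//.
case: k kN mlev => -[|k] /= klt kN mlev.
  apply: (le_trans (probability_le1 _ mlev)).
  rewrite lee_fin expr0 powR1 mulr1 mulr_ege1// -[leLHS](powRr0 2).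
  by rewrite ler_powR// ler1n.
rewrite exprS powRM ?exprn_ge0// (powRN 2) mulrA mulfK ?gt_eqF ?powR_gt0//.
apply: le_trans (tailX (2 ^+ k) _); last exact: exprn_gt0.
apply: le_measure; rewrite ?inE//.
  exact: measurable_superlevel.
move=> w /= lw; rewrite ltNge -(@dyadic_level_leP _ N) ?lw/= ?ltnn//.
Qed.

(** With [l = e * u], the product of [l] and the threshold is [u] plus [m * (expR 1 * e + 2) * u].
    The second part pays for the exponential moments, and [expR (- u)] remains. *)
Lemma capped_sum_tail (R : realType) (dT : measure_display)
    (T : measurableType dT) (P : probability T R) (n : nat)
    (W : 'I_n -> {RV P >-> R}) (d u B e m : R) (a : 'I_n -> R) (N : nat) :
  0 < d -> 1 <= u -> 1 <= B ->
  e = (3 * (3 + d))^-1 -> m = B * 2 `^ (1 + 2 * d) / (1 - 2 `^ (- d)) ->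
  mutually_independent W ->
  (forall i (t : R), 0 < t ->
     (P [set w | (t < W i w)%R] <= (B * t `^ (- (1 + 2 * d)))%:E)%E) ->
  (forall i, 0 <= a i) -> \sum_i a i <= 1 ->
  expR u * \sum_i a i `^ (1 + 3 * d) <= 1 ->
  (P [set w | ((1 + m * (expR 1 * e + 2)) / e <
      \sum_i capped (a i) (dyadic_level N (W i w)))%R] <= (expR (- u))%:E)%E.
Proof.
move=> d0 u1 B1 eE mE indW tailW a0 a1 ap1.
have e0 : 0 < e by rewrite eE invr_gt0; lra.
have l0 : 0 <= e * u by nra.
have r0 : 0 <= 1 + 2 * d by lra.
have m0 : 0 <= m.
  rewrite mE divr_ge0 ?mulr_ge0 ?powR_ge0//; first by lra.
  rewrite subr_ge0 powRN invf_le1 ?powR_gt0// -[leLHS](powRr0 2).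
  by rewrite ler_powR ?ler1n// ltW.
have mlev := @measurable_dyadic_level R N.
apply: (le_trans (chernoff_finite (fun i => capped (a i)) _ indW mlev l0)); rewrite lee_fin.
set l := e * u in l0 *.
have as2 : \sum_i a i `^ (1 + d) <= 2 * expR (- (u / 3)).
  apply: (@le_trans _ _ (\sum_i expR (- (u / 3)) * (a i + expR u * a i `^ (1 + 3 * d)))).
    by apply: ler_sum => i _; exact: powR_interpolate.
  rewrite -mulr_sumr big_split/= -mulr_sumr mulrC ler_wpM2r ?expR_ge0//.
  by lra.
have prod_le : \prod_i \sum_k fine (P [set w | dyadic_level N (W i w) = k]) *
       expR (l * capped (a i) k) <=
    expR (m * (expR 1 * l + expR (2 * l) * l `^ (1 + d) * (2 * expR (- (u / 3))))).
  apply: (@le_trans _ _ (\prod_i expR (m * (expR 1 * l * a i +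
      expR (2 * l) * l `^ (1 + d) * a i `^ (1 + d))))).
    apply: ler_prod => i _; apply/andP; split.
      by apply: sumr_ge0 => k _; rewrite mulr_ge0 ?expR_ge0// fine_ge0.
    (* Bounding [1 + x] by [expR x] turns the product over [i] into the exponential of a sum. *)
    apply: le_trans (expR_ge1Dx _).
    rewrite mE; apply: capped_mgf_le => //.
    - by rewrite mulr_ge0 ?powR_ge0//; lra.
    - by move=> k; exact: fine_ge0.
    - by apply: sum_fibers_le1 => k; exact: measurable_dyadic_level_RV.
    - by move=> k; apply: dyadic_level_prob_le => // t; exact: tailW.
  rewrite -expR_sum ler_expR -mulr_sumr ler_wpM2l// big_split/= -!mulr_sumr.
  rewrite lerD//; first by rewrite ler_piMr// mulr_ge0 ?expR_ge0.
  by rewrite ler_wpM2l// mulr_ge0 ?expR_ge0 ?powR_ge0.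
(* The choice of [e] is made here: [l ^ (1 + d) <= expR (l * (1 + d))], and [l * (3 + d) = u / 3]
   cancels the gain from interpolation exactly. *)
have small : expR (2 * l) * l `^ (1 + d) * expR (- (u / 3)) <= 1.
  apply: (@le_trans _ _ (expR (2 * l) * expR (l * (1 + d)) * expR (- (u / 3)))).
    rewrite ler_wpM2r ?expR_ge0// ler_wpM2l ?expR_ge0// expRM.
    rewrite ge0_ler_powR ?nnegrE ?expR_ge0//; first by lra.
    by apply: le_trans (expR_ge1Dx l); lra.
  rewrite -!expRD expR_le1 /l eE le_eqVlt; apply/orP; left; apply/eqP.
  by field; lra.
apply: (le_trans (ler_wpM2l (expR_ge0 _) prod_le)).
rewrite -expRD ler_expR.
have -> : l * ((1 + m * (expR 1 * e + 2)) / e) = u * (1 + m * (expR 1 * e + 2)).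
  by rewrite /l; field; rewrite gt_eqF.
have : m * (expR 1 * l + expR (2 * l) * l `^ (1 + d) * (2 * expR (- (u / 3)))) <=
       m * (expR 1 * e * u + 2 * u).
  rewrite ler_wpM2l//.
  have -> : expR 1 * l = expR 1 * e * u by rewrite mulrA.
  by rewrite lerD2l mulrCA; lra.
by lra.
Qed.

(* Scaling the weights by [K] large makes the bound [2 * exp (- u)] free of
   [p]-dependent factors, so that the constant [C] can be universal. *)
Lemma weighted_sum_tail (R : realType) (p : R) : 1 < p ->
  exists K L : R, [/\ 1 <= K, 0 < L &
    forall (dT : measure_display) (T : measurableType dT)
      (P : probability T R) (n : nat) (W : 'I_n -> {RV P >-> R}) (u : R)
      (a : 'I_n -> R),
    mutually_independent W ->
    (forall i (t : R), 0 < t -> P [set w | t < W i w] = (Wtail p t)%:E) ->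
    1 <= u -> (forall i, 0 <= a i) -> \sum_i a i <= K^-1 ->
    expR u * u `^ p * (\sum_i a i `^ p) <= K^-1 ->
    (P [set w | (L < \sum_i a i * W i w)%R] <= (2 * expR (- u))%:E)%E].
Proof.
move=> p1.
pose d := (p - 1) / 3.
have d0 : 0 < d by rewrite /d; lra.
have pE : p = 1 + 3 * d by rewrite /d; lra.
pose B := (expR 1 * (p / d)) `^ p.
pose D := (expR 1 * (2 + (2 * d)^-1)) `^ p + B.
have e1 := expR1_ge1 R.
have B1 : 1 <= B.
  have <- : 1 `^ p = 1 :> R by rewrite powR1.
  rewrite ge0_ler_powR ?nnegrE//; first by lra.
    by rewrite mulr_ge0 ?expR_ge0// divr_ge0; lra.
  by rewrite mulr_ege1// ler_pdivlMr//; lra.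
have D1 : 1 <= D by rewrite /D; have := powR_ge0 (expR 1 * (2 + (2 * d)^-1)) p; lra.
pose e := (3 * (3 + d))^-1.
have e0 : 0 < e by rewrite invr_gt0; lra.
pose m := B * 2 `^ (1 + 2 * d) / (1 - 2 `^ (- d)).
have m0 : 0 <= m.
  rewrite divr_ge0 ?mulr_ge0 ?powR_ge0//.
  rewrite subr_ge0 powRN invf_le1 ?powR_gt0// -[leLHS](powRr0 2).
  by rewrite ler_powR ?ler1n// ltW.
have K1 : 1 <= 2 * D by lra.
have KV1 : (2 * D)^-1 <= 1 by rewrite invf_le1; lra.
exists (2 * D), ((1 + m * (expR 1 * e + 2)) / e); split => //.
  by rewrite divr_gt0// ltr_pwDl// mulr_ge0// addr_ge0// mulr_ge0 ?expR_ge0// ltW.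
move=> dT T P n W u a indW tailW u1 a0 aK apK.
set L := _ / e.
have ai1 i : a i <= 1.
  apply: le_trans (le_trans aK KV1).
  by rewrite (bigD1 i)//= lerDl sumr_ge0.
have uexp := expR_gt0 u.
have up : 1 <= u `^ p.
  by rewrite -[leLHS](powRr0 u) ler_powR//; lra.
have S0 : 0 <= \sum_i a i `^ p by apply: sumr_ge0 => i _; exact: powR_ge0.
have tailB i (t : R) : 0 < t ->
    (P [set w | (t < W i w)%R] <= (B * t `^ (- (1 + 2 * d)))%:E)%E.
  move=> t0; rewrite tailW// lee_fin.
  apply: le_trans (@Wtail_le R p (1 + 2 * d) t _ _ _ t0) _; try lra.
  by rewrite (_ : p - (1 + 2 * d) = d)// /d; lra.
pose N := Num.bound (\sum_i (a i)^-1).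
have aN i : (a i)^-1 <= 2 ^+ N.
  apply: (@le_trans _ _ N%:R); last by rewrite -natrX ler_nat ltnW// ltn_expl.
  apply: le_trans (ltW (archi_boundP _)); last first.
    by apply: sumr_ge0 => j _; rewrite invr_ge0.
  by rewrite (bigD1 i)//= lerDl sumr_ge0// => j _; rewrite invr_ge0.
pose A1 := [set w | L < \sum_i a i * W i w].
pose A2 := [set w | L < \sum_i capped (a i) (dyadic_level N (W i w))].
have maW i : measurable_fun setT (fun w => a i * W i w) by exact: measurable_realfun.measurable_funM.
have mA1 : measurable A1.
  by apply: measurable_superlevel; exact: measurable_sum.
have mJ i : measurable [set w | 1 < a i * W i w] by exact: measurable_superlevel.
have mA2 : measurable A2.
  by apply: measurable_superlevel; apply: measurable_sum => i;
     apply: measurable_fun_fin => k; exact: measurable_dyadic_level_RV.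
have PA2 : (P A2 <= (expR (- u))%:E)%E.
  apply: (@capped_sum_tail R dT T P n W d u B e m) => //.
    exact: le_trans aK KV1.
  apply: le_trans (le_trans apK KV1).
  by rewrite -pE ler_wpM2r// ler_peMr// ltW.
(* Without a jump every term is at most its capped value, so the capped sum would exceed [L] too;
   outside [A2] some jump must therefore occur. *)
have PA12 : (P (A1 `\` A2) <= (expR (- u))%:E)%E.
  apply: (le_trans (union_bound P (Q := xpredT) (measurableD mA1 mA2) mJ _)).
    move=> w [A1w A2w]; apply: contrapT => nJ; apply: A2w.
    rewrite /A2/=; apply: (lt_le_trans A1w); apply: ler_sum => i _.
    apply: le_capped_dyadic => //; rewrite leNgt; apply/negP => J.
    by apply: nJ; exists i.
  apply: (le_trans (max_jump_tail pE d0 u1 tailW a0 ai1)).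
  rewrite lee_fin -/B -/D.
  (* The scale [2 * D] gives each of the two terms of [max_jump_tail] half of [expR (- u)]. *)
  have {2}-> : expR (- u) = D * ((2 * D)^-1 * expR (- u) + expR (- u) * (2 * D)^-1).
    by field; lra.
  rewrite ler_wpM2l//; first by lra.
  rewrite lerD//; last by rewrite ler_wpM2l ?expR_ge0.
  by rewrite expRN ler_pdivlMr// mulrC mulrA.
have -> : (2 * expR (- u))%:E = ((expR (- u))%:E + (expR (- u))%:E)%E.
  by rewrite -EFinD; congr EFin; lra.
apply: le_trans (leeD PA2 PA12).
apply: le_trans (measureU2 _ mA2 (measurableD mA1 mA2)).
apply: le_measure; rewrite ?inE//; first exact/measurableU/measurableD.
by move=> w A1w; have [|] := pselect (A2 w); [left|right].
Qed.

(** * Rescaling general weights *)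

Theorem proposition20 (R : realType) :
  exists (C : R) (Cq : R -> R),
    [/\ 0 < C,
        (forall q : R, 2 < q -> 0 < Cq q) &
        forall (n : nat) (q : R), 2 < q ->
        forall (d : measure_display) (T : measurableType d)
          (P : probability T R) (W : 'I_n -> {RV P >-> R}),
          iid W ->
          (forall i, {ae P, forall w, 0 <= W i w}) ->
          (forall (i : 'I_n) (t : R), 0 < t ->
             P [set w | t < W i w] =
             (expR (q / 2) * (expR 1 + t) `^ (- (q / 2))
                * ln (expR 1 + t) `^ (q / 2))%:E) ->
        forall (b : 'I_n -> R), (forall i, 0 <= b i) ->
        forall t : R, 0 < t ->
          ((1 - C * expR (- (t ^+ 2 / 2)))%:E <=
           P [set w | (\sum_(i < n) b i * W i w <=
                Cq q * (pnorm 1 b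
                        + t ^+ 2 * expR (t ^+ 2 / q) * pnorm (q / 2) b))%R])%E].
Proof.
(* The constants are made total in [q], with the dummy [(0, 0)] outside the range, so that choice
   yields functions of [q]. *)
have KLex q : exists KL : R * R, 2 < q -> [/\ 1 <= KL.1, 0 < KL.2 &
    forall (dT : measure_display) (T : measurableType dT)
      (P : probability T R) (n : nat) (W : 'I_n -> {RV P >-> R}) (u : R)
      (a : 'I_n -> R),
    mutually_independent W ->
    (forall i (t : R), 0 < t -> P [set w | t < W i w] = (Wtail (q / 2) t)%:E) ->
    1 <= u -> (forall i, 0 <= a i) -> \sum_i a i <= KL.1^-1 ->
    expR u * u `^ (q / 2) * (\sum_i a i `^ (q / 2)) <= KL.1^-1 ->
    (P [set w | (KL.2 < \sum_i a i * W i w)%R] <= (2 * expR (- u))%:E)%E].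
  have [q2|q2] := boolP (2 < q); last by exists (0, 0) => ?.
  have [|K [L KL]] := @weighted_sum_tail R (q / 2); first by lra.
  by exists (K, L).
have [KL KLP] := choice KLex.
exists (2 * expR 1), (fun q => (KL q).2 * (KL q).1); split.
- by rewrite mulr_gt0 ?expR_gt0.
- by move=> q /KLP [K1 L0 _]; rewrite mulr_gt0//; lra.
move=> n q q2 d T P W [indW _] _ tailW b b0 t t0.
have [K1 L0 {}KLP] := KLP q q2.
set K := (KL q).1 in K1 KLP *; set L := (KL q).2 in L0 KLP *.
set p := q / 2 in tailW KLP *.
have p1 : 1 < p by rewrite /p; lra.
have p0 : 0 < p by lra.
have K0 : 0 < K by lra.
set u := t ^+ 2 / 2.
have t2u : t ^+ 2 = 2 * u by rewrite /u; lra.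
have tq : t ^+ 2 / q = u / p by rewrite /u /p; field; lra.
have u0 : 0 < u by rewrite /u divr_gt0// exprn_gt0.
have n1E : pnorm 1 b = \sum_i b i.
  rewrite /pnorm invr1 powRr1; last by apply: sumr_ge0 => i _; exact: powR_ge0.
  by apply: eq_bigr => i _; rewrite powRr1// ger0_norm.
have npE : pnorm p b `^ p = \sum_i b i `^ p.
  rewrite /pnorm -powRrM mulVf ?powRr1; last by rewrite gt_eqF.
    by apply: eq_bigr => i _; rewrite ger0_norm.
  by apply: sumr_ge0 => i _; exact: powR_ge0.
have np0 : 0 <= pnorm p b := powR_ge0 _ _.
clearbody u p; rewrite tq t2u n1E.
have b10 : 0 <= \sum_i b i by apply: sumr_ge0.
set S := \sum_i b i + _.
have [u1|u1] := ltP u 1.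
  apply: (@le_trans _ _ 0%E) => //; rewrite lee_fin subr_le0 -mulrA -expRD.
  have : 1 <= expR (1 - u) by rewrite -[leLHS]expR0 ler_expR subr_ge0 ltW.
  by move=> E1; rewrite (le_trans E1)// ler_peMl ?expR_ge0// ler1n.
have bS : \sum_i b i <= S.
  by rewrite /S lerDl !mulr_ge0 ?expR_ge0 ?(ltW u0).
have unS : u * expR (u / p) * pnorm p b <= S.
  rewrite /S -!mulrA ler_wpDl// ler_peMl ?ler1n// !mulr_ge0 ?expR_ge0//.
  exact: ltW.
clearbody S.
(* If all weights vanish, [S] may be 0 and cannot serve as a scale; the sum is then 0 and the event
   is certain. *)
have [b0E|bn0] := eqVneq (\sum_i b i) 0.
  rewrite (_ : [set w | _] = setT) ?probability_setT ?lee_fin.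
    by rewrite gerBl !mulr_ge0 ?expR_ge0.
  apply/seteqP; split => w //= _; rewrite big1 => [|i _].
    by rewrite !mulr_ge0 ?(ltW L0) ?(ltW K0)// (le_trans b10).
  by rewrite (psumr_eq0P _ b0E) ?mul0r.
have S0 : 0 < S by rewrite (lt_le_trans _ bS)// lt_neqAle eq_sym bn0.
have KS0 : 0 < K * S by rewrite mulr_gt0.
pose a i := b i / (K * S).
have aWE w : \sum_i a i * W i w = (\sum_i b i * W i w) / (K * S).
  by rewrite mulr_suml; apply: eq_bigr => i _; rewrite mulrAC.
have -> : [set w | \sum_i b i * W i w <= L * K * S] =
          ~` [set w | L < \sum_i a i * W i w].
  apply/seteqP; split => w /=; rewrite aWE ltr_pdivlMr// -mulrA.
    by move=> H /(le_lt_trans H); rewrite ltxx.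
  by move/negP; rewrite -leNgt.
rewrite probability_setC; last first.
  by apply: measurable_superlevel; apply: measurable_sum => i; exact: measurable_realfun.measurable_funM.
rewrite EFinB leeB// -mulrA -expRD.
apply: le_trans (KLP d T P n W u a indW _ u1 _ _ _) _.
- by move=> i x x0; rewrite tailW// WtailE ?ltW.
- by move=> i; rewrite divr_ge0// ltW.
- by rewrite -mulr_suml ler_pdivrMr// mulrA mulVf ?mul1r// gt_eqF.
- have -> : \sum_i a i `^ p = pnorm p b `^ p / (K * S) `^ p.
    rewrite npE mulr_suml; apply: eq_bigr => i _.
    by rewrite /a powRM ?invr_ge0 ?(ltW KS0)// -powR_inv1 ?(ltW KS0)// powRAC powR_inv1 ?powR_ge0.
  (* The factor [expR (u / p)] in the statement becomes the [expR u] required by the tail bound once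
     raised to the power [p]. The remaining [K ^ p >= K] supplies [K^-1]. *)
  have ue : (u * expR (u / p) * pnorm p b) `^ p = expR u * u `^ p * pnorm p b `^ p.
    rewrite !powRM ?mulr_ge0 ?expR_ge0 ?(ltW u0)// -expRM divfK ?gt_eqF//.
    by rewrite (mulrC (u `^ p)).
  rewrite mulrA -ue (powRM p (ltW K0) (ltW S0)).
  have Kp : K <= K `^ p by rewrite le1r_powR// ltW.
  have Sp : (u * expR (u / p) * pnorm p b) `^ p <= S `^ p.
    by rewrite ge0_ler_powR ?nnegrE ?mulr_ge0 ?expR_ge0 ?(ltW u0) ?(ltW p0) ?(ltW S0)//.
  rewrite ler_pdivrMr ?mulr_gt0 ?powR_gt0//.
  apply: (le_trans Sp); rewrite mulrA ler_peMl ?powR_ge0//.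
  by rewrite mulrC ler_pdivlMr ?mul1r.
- by rewrite lee_fin ler_wpM2l// ler_expR lerDr.
Qed.
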